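(* Consider a finite action sequence $a_1,\dots,a_T$ describing a sequential search process with multi-stage information acquisition (as defined in the context) that satisfies Independence and Invariance, where $a_j$ is the action selected at step $j$. Suppose the consumer ranks all actions that are feasible at some step of the process. Then the process is optimal if and only if, in the corresponding ranking: 1. $a_j\succ a_{j+t}$ for all $j$ and all positive integers $t$ such that $a_{j+t}$ is feasible at step $j$; 2. every unselected action $\ell$ (every action feasible at some step but never selected) ranks lower than its $\ell$-conditional preventive action $\bar a_\ell$.
   Context: Process. There is a set of actions (of arbitrary types, e.g. discovering, inspecting, purchasing), a finite nonempty subset of which is initially feasible. Every action that is not initially feasible has exactly one parent action, so the parent-child relation is a forest rooted at the initially feasible actions, of arbitrary depth; each action has finitely many (possibly no) children. At each step $j=1,\dots,T$ the consumer selects one action $a_j$ from the set $\mathcal{A}_j$ of currently feasible actions: $\mathcal{A}_1$ is the set of initially feasible actions, and $\mathcal{A}_{j+1}$ is obtained from $\mathcal{A}_j$ by removing $a_j$ and adding all children of $a_j$. Each action can be selected at most once. Each action $a$ has a real value $v(a)$ (its Gittins index). Independence and Invariance mean that these values are fixed throughout the process and that a feasible action stays feasible until it is selected. Optimal: at every step the selected action is the feasible action with the highest value (the Gittins index policy). There are no ties: distinct actions have distinct values. Ranking: $a\succ b$ means $v(a)>v(b)$. Forward-accessibility: a step is forward-accessible if some action feasible at that step is selected in a subsequent step; otherwise it is forward-inaccessible (so the last step is always forward-inaccessible). $\ell$-conditional preventive action $\bar a_\ell$: the lowest-ranked action among the actions selected at those forward-inaccessible steps at which $\ell$ is feasible;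 its value is the minimum of the values of those selected actions. *)

(* Defs.v *)
From HB Require Import structures.
From mathcomp Require Import all_boot all_order all_algebra.
From mathcomp Require Import finmap.
From mathcomp Require Import reals.

Set Implicit Arguments.
Unset Strict Implicit.
Unset Printing Implicit Defensive.

Import Order.TTheory GRing.Theory Num.Theory.

Local Open Scope fset_scope.
Local Open Scope ring_scope.

(* [forest_rooted] excludes cycles and infinite ancestor chains, while allowing
   infinitely many actions and unbounded depth. *)
Record forest (A : choiceType) := Forest {
  roots : {fset A};
  children : A -> {fset A};
  roots_neq0 : roots != fset0;
  root_parentless : forall a b : A, b \in roots -> b \notin children a;
  parent_unique : forall b : A, b \notin roots -> exists! a : A, b \in children a;
  forest_rooted : forall b : A, exists2 r : A, r \in roots &
    exists2 p : seq A, path (fun x y => y \in children x) r p & last r p = b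
}.

(* Steps are numbered from 0, and a sequence a of T = n.+1 actions has the steps
   j : 'I_n.+1, with selected action [tnth a j]. *)
Section Process.
Variables (R : realType) (A : choiceType) (F : forest A) (v : A -> R).
Variables (n : nat) (a : n.+1.-tuple A).

Definition update (S : {fset A}) (x : A) : {fset A} :=
  (S `\ x) `|` children F x.

Definition feasible (j : nat) : {fset A} := foldl update (roots F) (take j a).

Definition search_process : Prop :=
  (forall j : 'I_n.+1, tnth a j \in feasible j) /\ uniq a.

Definition ranks_above (x y : A) : Prop := v y < v x.

Definition optimal : Prop :=
  forall (j : 'I_n.+1) (b : A), b \in feasible j -> v b <= v (tnth a j).

Definition forward_accessible (j : 'I_n.+1) : bool :=
  [exists k : 'I_n.+1, (j < k)%N && (tnth a k \in feasible j)].

Definition unselected (l : A) : Prop :=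
  (exists j : 'I_n.+1, l \in feasible j) /\ l \notin a.

(* The default index [ord_max] is the last step: it is forward-inaccessible, and
   an unselected action is still feasible there, so that it always qualifies
   (see [preventive_actionP]). *)
Definition preventive_action (l : A) : A :=
  tnth a [arg min_(j < ord_max | ~~ forward_accessible j && (l \in feasible j))
            v (tnth a j)]%O.

Lemma last_step_inaccessible : ~~ forward_accessible ord_max.
Proof.
apply/existsPn => k; rewrite negb_and -leqNgt.
by apply/orP; left; rewrite -ltnS ltn_ord.
Qed.

Lemma feasibleS (j : 'I_n.+1) : feasible j.+1 = update (feasible j) (tnth a j).
Proof.
rewrite /feasible (take_nth (tnth a ord0)) ?size_tuple //.
by rewrite foldl_rcons -tnth_nth.
Qed.

Lemma unselected_stays (l : A) (i j : nat) : l \notin a -> (i <= j <= n)%N ->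
  l \in feasible i -> l \in feasible j.
Proof.
move=> la /andP[ij jn] li; elim: j ij jn => [|j IH].
  by rewrite leqn0 => /eqP <-.
rewrite leq_eqVlt => /orP[/eqP <- //|ij] jn.
have jn1 : (j < n.+1)%N by rewrite ltnS ltnW.
have -> : feasible j.+1 = _ := feasibleS (Ordinal jn1).
rewrite /update in_fsetU in_fsetD1 (IH ij (ltnW jn)) andbT.
by apply/orP; left; apply: contraNneq la => ->; apply: mem_tnth.
Qed.

Lemma preventive_actionP (l : A) : unselected l ->
  exists j : 'I_n.+1,
    [/\ ~~ forward_accessible j, l \in feasible j,
        preventive_action l = tnth a j &
        forall k : 'I_n.+1, ~~ forward_accessible k -> l \in feasible k ->
          v (tnth a j) <= v (tnth a k)].
Proof.
move=> [[i li] la]; rewrite /preventive_action; case: arg_minP => [|j].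
  rewrite last_step_inaccessible.
  by apply: (unselected_stays la _ li); rewrite -ltnS ltn_ord /=.
move=> /andP[nj lj] jmin; exists j; split=> // k nk lk.
by apply: jmin; rewrite nk.
Qed.

End Process.

(* Main.v *)
(* If a step is forward-accessible, then by condition 1 its action ranks above
   some later selected action that was already feasible at that step; repeating
   this reaches a forward-inaccessible step, at which an unselected action is
   still feasible. Hence condition 2, a bound at forward-inaccessible steps only,
   propagates back to every step. *)

Require Import Defs.
From mathcomp Require Import all_boot all_order all_algebra.
From mathcomp Require Import finmap.
From mathcomp Require Import reals.

Import Order.TTheory GRing.Theory Num.Theory.

Local Open Scope ring_scope.

Lemma feasible_origin {A : choiceType} {F : forest A} {n : nat}
    {a : n.+1.-tuple A} {x : A} {j : nat} :
  (j <= n.+1)%N -> x \in feasible F a j ->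
  x \in Defs.roots F \/
  exists2 i : 'I_n.+1, (i < j)%N & x \in children F (tnth a i).
Proof.
elim: j => [_|j IH lt_jn]; first by rewrite /feasible take0; left.
rewrite (feasibleS F a (Ordinal lt_jn)) /update in_fsetU in_fsetD1.
case/orP => [/andP[_ xj]|xc]; last by right; exists (Ordinal lt_jn).
have [|[i lt_ij xi]] := IH (ltnW lt_jn) xj; first by left.
by right; exists i => //; apply: ltnW.
Qed.

(** A selected action could return only as a child of an action selected at step [i] or later. A
    root has no parent. A non-root entered as a child of an action selected before [i]; as parents
    are unique and no action is selected twice, the two parent steps coincide, which is absurd. *)
Lemma selected_not_feasible {A : choiceType} {F : forest A} {n : nat}
    {a : n.+1.-tuple A} {i : 'I_n.+1} {j : nat} :
  search_process F a -> (i < j <= n.+1)%N -> tnth a i \notin feasible F a j.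
Proof.
move=> [feas /tuple_uniqP a_inj] /andP[].
elim: j => [//|j IH] le_ij lt_jn.
rewrite (feasibleS F a (Ordinal lt_jn)) /update in_fsetU in_fsetD1 negb_or.
apply/andP; split.
  rewrite negb_and negbK; have [-> | lt_ij] := eqVneq i (Ordinal lt_jn).
    by rewrite eqxx.
  by rewrite IH ?orbT ?(ltnW lt_jn) // ltn_neqAle lt_ij -ltnS.
have le_in : (i <= n.+1)%N by apply: ltnW.
have [ri|[p lt_pi pi]] := feasible_origin le_in (feas i).
  exact: root_parentless.
apply/negP => ci.
have /(parent_unique (f := F)) [q [_ q_uniq]] : tnth a i \notin Defs.roots F.
  by apply: contraL pi; apply: root_parentless.
have /a_inj e : tnth a p = tnth a (Ordinal lt_jn).
  by rewrite -(q_uniq _ pi) (q_uniq _ ci).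
by move: lt_pi; rewrite e /= ltnNge -ltnS le_ij.
Qed.

Theorem theorem3 (R : realType) (A : choiceType) (F : forest A) (v : A -> R)
    (n : nat) (a : n.+1.-tuple A)
    (v_inj : injective v) (a_process : search_process F a) :
  optimal F v a <->
  (forall j k : 'I_n.+1, (j < k)%N -> tnth a k \in feasible F a j ->
     ranks_above v (tnth a j) (tnth a k)) /\
  (forall l : A, unselected F a l ->
     ranks_above v (preventive_action F v a l) l).
Proof.
split=> [opt|[later unsel]].
  split=> [j k lt_jk kj|l ul]; rewrite /ranks_above lt_neqAle.
    rewrite opt // andbT (inj_eq v_inj); case: a_process => _ /tuple_uniqP a_inj.
    by rewrite (inj_eq a_inj) -val_eqE neq_ltn lt_jk orbT.
  (* The preventive action is selected at a step where [l] is feasible, so optimality compares them;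
     the inequality is strict because [l] is never selected. *)
  have [j [_ lj -> _]] := preventive_actionP v ul.
  rewrite opt // andbT (inj_eq v_inj); case: ul => _.
  by apply: contraNneq => ->; apply: mem_tnth.
move=> j b bj; have [/tnthP[k eb]|b_unsel] := boolP (b \in a).
  rewrite {b}eb in bj *; case: (ltngtP j k) => [lt_jk|lt_kj|/val_inj -> //].
    exact/ltW/later.
  have lt_kjn : (k < j <= n.+1)%N by rewrite lt_kj ltnW.
  by have /negP := selected_not_feasible a_process lt_kjn.
have ub : unselected F a b by split=> //; exists j.
have [m [_ _ pb m_min]] := preventive_actionP v ub.
have lt_bm : v b < v (tnth a m) by rewrite -pb; apply: unsel.
(* The bound [lt_bm] does not depend on [j], since [m] minimizes over all forward-inaccessible steps
   at which [b] is feasible. This allows induction on the number of steps left after [j]. *)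
have [d] := ubnP (n - j); elim: d j bj => // d IH j bj lt_jd.
have [|inacc] := boolP (forward_accessible F a j).
  case/existsP => k /andP[lt_jk kj].
  apply: le_trans (ltW (later _ _ lt_jk kj)).
  have le_kn : (k <= n)%N by rewrite -ltnS.
  apply: IH.
    by apply: (unselected_stays b_unsel _ bj); rewrite (ltnW lt_jk).
  rewrite -ltnS; apply: leq_trans lt_jd.
  by apply: ltn_sub2l => //; apply: leq_trans le_kn.
exact: le_trans (ltW lt_bm) (m_min _ inacc bj).
Qed.
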